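(* Let $B_1,\ldots,B_N$ be invertible $d\times d$ contraction matrices such that $\sum_{i=1}^{N}\|B_i\|<1$. Then the set $E_d(B_1,\ldots,B_N)$ is a dense $G_\delta$-subset of $\mathbb R^{dN}$.
   Context: $\mathbb N=\{1,2,\ldots\}$, $d,N\in\mathbb N$. Matrices are real. For a matrix $B$, $\|B\|=\max_{\mathbf x\neq\mathbf 0}\frac{|B\mathbf x|}{|\mathbf x|}$ is the Euclidean operator norm, and $B$ is a contraction matrix if $\|B\|<1$. For contracting homeomorphisms $w_1,\ldots,w_N$ of $\mathbb R^d$ onto itself, the attractor $A$ is the unique non-empty compact set with $A=\bigcup_{i=1}^N w_i(A)$. Let $\Sigma=\{1,\ldots,N\}$ and $w_{\mathbf i}=w_{i_1}\circ\cdots\circ w_{i_n}$ for $\mathbf i=(i_1,\ldots,i_n)\in\Sigma^n$. The system $(w_1,\ldots,w_N)$ satisfies the strong Markov property (SMP) if for every $n\in\mathbb N$ there is an open set $\mathcal O_n\subset\mathbb R^d$ such that (1) $\overline{\mathcal O_n\cap A}=A$; and (2) $w_{\mathbf i}(\mathcal O_n)\cap w_{\mathbf j}(\mathcal O_n)=\emptyset$ for all $\mathbf i\neq\mathbf j\in\Sigma^n$. $E_d(B_1,\ldots,B_N)$ is the set of all ordered $N$-tuples $(\boldsymbol\alpha_1,\ldots,\boldsymbol\alpha_N)$ of points of $\mathbb R^d$ such that the system $w_i(\mathbf x)=B_i(\mathbf x-\boldsymbol\alpha_i)+\boldsymbol\alpha_i$, $i=1,\ldots,N$, satisfies the SMP;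 it is regarded as a subset of $\mathbb R^{dN}$ with the Euclidean topology. *)

(* Defs.v *)
From HB Require Import structures.
From mathcomp Require Import all_boot all_order all_algebra.
From mathcomp Require Import all_classical all_reals all_analysis.

Set Implicit Arguments.
Unset Strict Implicit.
Unset Printing Implicit Defensive.

Import Order.TTheory GRing.Theory Num.Theory.
Import numFieldNormedType.Exports.

Local Open Scope classical_set_scope.
Local Open Scope ring_scope.

(* The library norm on matrices is the sup norm of the entries; it induces the
   Euclidean topology, but the metric notions here need the Euclidean norm. *)
Definition enorm (R : realType) (d : nat) (x : 'cV[R]_d) : R :=
  Num.sqrt (\sum_(k < d) x k ord0 ^+ 2).

(* For 0 < d the supremum is attained, so it is the usual maximum. *)
Definition opnorm (R : realType) (d : nat) (B : 'M[R]_d) : R :=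
  sup [set enorm (B *m x) / enorm x | x in [set x : 'cV[R]_d | x != 0]].

Definition contraction_mx (R : realType) (d : nat) (B : 'M[R]_d) : Prop :=
  opnorm B < 1.

Section IFS.
Variables (R : realType) (d N : nat).
Implicit Type w : 'I_N -> 'cV[R]_d -> 'cV[R]_d.

Definition is_attractor w (A : set 'cV[R]_d) : Prop :=
  [/\ A !=set0, compact A & A = \bigcup_(i in [set: 'I_N]) (w i @` A)].

(* For contracting w and 0 < N exactly one set satisfies is_attractor w, and
   xget selects it; set0 is only the default value when there is none. *)
Definition attractor w : set 'cV[R]_d := xget set0 [set A | is_attractor w A].

Definition word_map w (s : seq 'I_N) : 'cV[R]_d -> 'cV[R]_d :=
  foldr (fun i f => w i \o f) id s.

Definition SMP w : Prop :=
  forall n : nat, (0 < n)%N ->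
    exists O : set 'cV[R]_d,
      [/\ open O,
          closure (O `&` attractor w) = attractor w
        & forall s t : n.-tuple 'I_N, s != t ->
            (word_map w s @` O) `&` (word_map w t @` O) = set0].

Definition affine_ifs (B : 'I_N -> 'M[R]_d) (alpha : 'I_N -> 'cV[R]_d) :
    'I_N -> 'cV[R]_d -> 'cV[R]_d :=
  fun i x => B i *m (x - alpha i) + alpha i.

(* A point of R^(dN), i.e. an N-tuple of points of R^d, is a d x N matrix whose
   i-th column is the i-th point; the topology of 'M[R]_(d, N) is the product
   topology of its entries, that is, the Euclidean topology of R^(dN). *)
Definition E_set (B : 'I_N -> 'M[R]_d) : set 'M[R]_(d, N) :=
  [set alpha | SMP (affine_ifs B (fun i => col i alpha))].

End IFS.

(* Main.v *)
Require Import Defs.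
From HB Require Import structures.
From mathcomp Require Import all_boot all_order all_algebra.
From mathcomp Require Import all_classical all_reals all_analysis borel_hierarchy.
From mathcomp Require Import ring lra.
Import Order.TTheory GRing.Theory Num.Theory.
Import numFieldNormedType.Exports.
Local Open Scope classical_set_scope.
Local Open Scope ring_scope.
Set Implicit Arguments.
Unset Strict Implicit.
Unset Printing Implicit Defensive.

(** Why the theorem holds. Write S < 1 for the sum of the norms of the B_i, w_p
for the composition along a word p and A for the attractor.

The strong Markov property says that for every word p the set w_p(A) is not
contained in the union of the w_q(A) over the other words q of the same length
as p. If O is the open set of the property, then w_p(O) is open and disjoint
from w_q(O), in which w_q(A) is approximated, so w_p sends O out of every
w_q(A) (SMP_escape). Conversely, applying the condition to the words g u with
g of length n, and shrinking a cylinder once for each g, gives in every cylinder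
w_u(A) a smaller one on which all the w_g with g of length n avoid all the other
pieces w_h(A) (escape_refine). The points x for which the numbers
|w_g x - w_h y|, with h different from g and y in A, are bounded below by some e
larger than the distance from x to A then form an open set as required: if
w_g x = w_h x', the point with the smaller e is that close to A, and since the
maps do not increase distances, its image is too close to a piece that the image
of the other point avoids (escape_SMP).

All this is measured on nodes: node a s is the image under w_s of the fixed
point of w_i0, for one chosen letter i0. It is a point of A, it is linear in the
tuple a of fixed points, and w_s(A) lies within ratio s * (2 * radius a) of it.
The condition for p, called escape p, is therefore an inequality between nodes
with a positive margin. Linearity gives |node a s - node b s| <= radius (a - b)
for all words s at once, so the margin survives a small change of a and escape p
is open (escape_open). There are countably many words, hence the G_delta part.

By the Baire category theorem density reduces to that of a single escape p
(escape_dense), and this is where S < 1 is used. The balls of radius S |B_i| can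
be placed pairwise disjoint on a diameter of the ball of radius S, which gives a
tuple b whose node p keeps a distance c > 0 from the node of every long word s
that does not extend p (exists_separating_direction). On the line a0 + t b the
difference of the two nodes has the form x_s + t y_s with |y_s| >= c, so the
parameters t at which it is smaller than a constant times ratio s lie in a set
of diameter at most a constant times ratio s. The sum of these diameters over
all words of length k is a constant times S ^ k. For large k the sets cannot
cover a given interval of parameters (exists_uncovered), and an uncovered t
gives a point of escape p near a0. *)

(** * The Euclidean norm *)

Section EuclideanNorm.
Context {R : realType} {d : nat}.
Implicit Types (x y : 'cV[R]_d) (B : 'M[R]_d).

Lemma enorm_ge0 x : 0 <= enorm x.
Proof. exact: sqrtr_ge0. Qed.

Lemma sqr_enorm x : enorm x ^+ 2 = \sum_(k < d) x k ord0 ^+ 2.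
Proof. by rewrite sqr_sqrtr// sumr_ge0// => k _; rewrite sqr_ge0. Qed.

Lemma enorm0 : enorm (0 : 'cV[R]_d) = 0.
Proof. by rewrite /enorm big1 ?sqrtr0// => k _; rewrite mxE expr0n. Qed.

Lemma enormZ (a : R) x : enorm (a *: x) = `|a| * enorm x.
Proof.
rewrite /enorm (eq_bigr (fun k => a ^+ 2 * x k ord0 ^+ 2)); last first.
  by move=> k _; rewrite mxE exprMn.
by rewrite -mulr_sumr sqrtrM ?sqr_ge0// sqrtr_sqr.
Qed.

Lemma enormN x : enorm (- x) = enorm x.
Proof. by rewrite -scaleN1r enormZ normrN1 mul1r. Qed.

Lemma enormBC x y : enorm (x - y) = enorm (y - x).
Proof. by rewrite -enormN opprB. Qed.

Lemma coord_le_enorm x k : `|x k ord0| <= enorm x.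
Proof.
rewrite -sqrtr_sqr ler_sqrt ?sumr_ge0// => [|i _]; last exact: sqr_ge0.
by rewrite (bigD1 k)//= lerDl sumr_ge0// => i _; exact: sqr_ge0.
Qed.

Lemma enorm_eq0 x : enorm x = 0 -> x = 0.
Proof.
move=> x0; apply/matrixP => k j; rewrite ord1 mxE; apply/eqP.
by rewrite -normr_le0 -x0 coord_le_enorm.
Qed.

(** The sum of the squares of b x_k - a y_k, with a and b the norms of x and y,
is 2 a b (a b - x.y) and is nonnegative. *)
Lemma cauchy_schwarz x y :
  \sum_(k < d) x k ord0 * y k ord0 <= enorm x * enorm y.
Proof.
have [/enorm_eq0->|x0] := eqVneq (enorm x) 0.
  by rewrite enorm0 mul0r big1// => k _; rewrite mxE mul0r.
have [/enorm_eq0->|y0] := eqVneq (enorm y) 0.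
  by rewrite enorm0 mulr0 big1// => k _; rewrite mxE mulr0.
set a := enorm x in x0 *; set b := enorm y in y0 *.
have ab : 0 < a * b by rewrite mulr_gt0// lt_neqAle eq_sym ?x0 ?y0 enorm_ge0.
have : 0 <= \sum_(k < d) (b * x k ord0 - a * y k ord0) ^+ 2.
  by rewrite sumr_ge0// => k _; exact: sqr_ge0.
rewrite (eq_bigr (fun k => b ^+ 2 * x k ord0 ^+ 2 + a ^+ 2 * y k ord0 ^+ 2
  - 2 * (a * b) * (x k ord0 * y k ord0))); last by move=> k _; ring.
rewrite big_split big_split/= sumrN -!mulr_sumr -!sqr_enorm -/a -/b.
move=> ?; rewrite -(ler_pM2l ab); lra.
Qed.

Lemma enormD x y : enorm (x + y) <= enorm x + enorm y.
Proof.
rewrite -(ler_pXn2r (isT : (0 < 2)%N)) ?nnegrE ?addr_ge0 ?enorm_ge0//.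
rewrite sqrrD !sqr_enorm.
rewrite (eq_bigr (fun k => x k ord0 ^+ 2 + x k ord0 * y k ord0 *+ 2
  + y k ord0 ^+ 2)); last by move=> k _; rewrite mxE sqrrD.
rewrite big_split/= big_split/= sumrMnl lerD2r lerD2l.
by rewrite lerMn2r cauchy_schwarz.
Qed.

Lemma enormB_le x y z : enorm (x - z) <= enorm (x - y) + enorm (y - z).
Proof. by rewrite (le_trans _ (enormD _ _))// addrA subrK. Qed.

Lemma norm_le_enorm x : `|x| <= enorm x.
Proof.
rewrite [leLHS]/Num.Def.normr/= mx_normrE bigmax_le ?enorm_ge0//.
by case=> i j _ /=; rewrite ord1 coord_le_enorm.
Qed.

Lemma coord_le_norm {m n} (A : 'M[R]_(m, n)) i j : `|A i j| <= `|A|.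
Proof.
rewrite [leRHS]/Num.Def.normr/= mx_normrE.
exact: (le_bigmax _ (fun ij : 'I_m * 'I_n => `|A ij.1 ij.2|) (i, j)).
Qed.

Lemma enorm_le_sum x : enorm x <= \sum_(k < d) `|x k ord0|.
Proof.
have s0 : 0 <= \sum_(k < d) `|x k ord0| by rewrite sumr_ge0.
rewrite -(ger0_norm s0) -sqrtr_sqr ler_sqrt ?sqr_ge0//.
rewrite expr2 mulr_suml ler_sum// => k _.
rewrite -real_normK ?num_real// expr2 ler_wpM2l//.
by rewrite (bigD1 k)//= lerDl sumr_ge0.
Qed.

Lemma enorm_le_norm {m} (A : 'M[R]_(d, m)) (j : 'I_m) :
  enorm (col j A) <= d%:R * `|A|.
Proof.
apply: le_trans (enorm_le_sum _) _.
have -> : d%:R * `|A| = \sum_(k < d) `|A| by rewrite sumr_const card_ord mulr_natl.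
rewrite ler_sum// => k _.
by rewrite mxE coord_le_norm.
Qed.

Lemma mulmx_enorm_bounded B : exists K, forall x, enorm (B *m x) <= K * enorm x.
Proof.
exists (\sum_(k < d) \sum_(l < d) `|B k l|) => x.
apply: le_trans (enorm_le_sum _) _.
rewrite mulr_suml ler_sum// => k _; rewrite mxE mulr_suml.
apply: le_trans (ler_norm_sum _ _ _) _.
by rewrite ler_sum// => l _; rewrite normrM ler_wpM2l// coord_le_enorm.
Qed.

(** The operator norm is a supremum, so this needs that the quotients are
bounded above; otherwise the supremum would be a default value. *)
Lemma enorm_mulmx B x : enorm (B *m x) <= opnorm B * enorm x.
Proof.
have [->|x0] := eqVneq x 0; first by rewrite mulmx0 enorm0 mulr0.
have ex : 0 < enorm x.
  by rewrite lt_neqAle enorm_ge0 andbT eq_sym; apply: contra_neq x0 => /enorm_eq0.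
rewrite -ler_pdivrMr//; apply: ub_le_sup; last by exists x.
have [K BK] := mulmx_enorm_bounded B; exists K => _ [y y0 <-].
rewrite ler_pdivrMr//.
by rewrite lt_neqAle enorm_ge0 andbT eq_sym; apply: contra_neq y0 => /enorm_eq0.
Qed.

Lemma opnorm_gt0 B : (0 < d)%N -> B \in unitmx -> 0 < opnorm B.
Proof.
move=> d0 Bu; pose x : 'cV[R]_d := const_mx 1.
have x0 : x != 0.
  apply/eqP => /matrixP/(_ (Ordinal d0) ord0); rewrite !mxE => /eqP.
  by rewrite oner_eq0.
have gt0 (y : 'cV[R]_d) : y != 0 -> 0 < enorm y.
  move=> y0; rewrite lt_neqAle enorm_ge0 andbT eq_sym.
  by apply: contra_neq y0 => /enorm_eq0.
rewrite -(pmulr_lgt0 _ (gt0 _ x0)) (lt_le_trans _ (enorm_mulmx B x))//.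
by apply: gt0; apply: contra_neq x0 => Bx0; rewrite -(mulKmx Bu x) Bx0 mulmx0.
Qed.

Lemma enorm_mulmx_ge B : B \in unitmx ->
  exists2 m, 0 < m & forall x, m * enorm x <= enorm (B *m x).
Proof.
move=> Bu; have [K BK] := mulmx_enorm_bounded (invmx B).
exists (`|K| + 1)^-1 => [|x]; first by rewrite invr_gt0 ltr_wpDl.
rewrite ler_pdivrMl ?ltr_wpDl//.
rewrite -{1}(mulKmx Bu x) (le_trans (BK _))// ler_wpM2r ?enorm_ge0//.
by rewrite (le_trans (ler_norm _))// lerDl.
Qed.

(** The topology of matrices is that of the sup norm, which is equivalent to
the Euclidean norm. *)
Lemma nbhs_enorm x (U : set 'cV[R]_d) :
  nbhs x U <-> exists2 e, 0 < e & forall y, enorm (y - x) < e -> U y.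
Proof.
split=> [/nbhs_ballP[e /= e0 xU]|[e e0 xU]].
  exists e => // y yx; apply: xU; rewrite -ball_normE /= distrC.
  exact: le_lt_trans (norm_le_enorm _) yx.
apply/nbhs_ballP; exists (e / (d%:R + 1)) => /=; first by rewrite divr_gt0 ?ltr_wpDl.
move=> y; rewrite -ball_normE /= ltr_pdivlMr ?ltr_wpDl// => xy; apply: xU.
have -> : y - x = col ord0 (y - x) by apply/matrixP => i j; rewrite !mxE ord1.
apply: le_lt_trans (enorm_le_norm _ _) _; rewrite distrC.
by apply: le_lt_trans xy; rewrite mulrC ler_wpM2l// lerDl.
Qed.

Lemma open_enorm (U : set 'cV[R]_d) :
  (forall x, U x -> exists2 e, 0 < e & forall y, enorm (y - x) < e -> U y) ->
  open U.
Proof. by move=> UP; rewrite openE => x /UP /nbhs_enorm. Qed.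

Lemma closure_enorm (U : set 'cV[R]_d) x :
  closure U x <-> forall e, 0 < e -> exists2 y, U y & enorm (y - x) < e.
Proof.
split=> [Ux e e0|Ux V /nbhs_enorm[e e0 xV]].
  have /Ux[y [Uy ye]] : nbhs x [set y | enorm (y - x) < e].
    by apply/nbhs_enorm; exists e.
  by exists y.
by have [y Uy /xV Vy] := Ux e e0; exists y.
Qed.

(** Column vectors are reached by transposition from row vectors, for which
closed bounded sets are known to be compact. *)
Lemma bounded_closed_compact_cV (A : set 'cV[R]_d) M :
  (forall x, A x -> enorm x <= M) -> closed A -> compact A.
Proof.
move=> AM Ac.
have tr_norm (x : 'rV[R]_d) : `|x^T| <= `|x|.
  rewrite [leLHS]/Num.Def.normr/= mx_normrE bigmax_le// => -[i j] _ /=.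
  by rewrite mxE coord_le_norm.
have tr_cont : continuous (@trmx R 1 d).
  move=> x U /nbhs_ballP[e e0 xU]; apply/nbhs_ballP.
  exists e => // y; rewrite -ball_normE /= => xy; apply: xU.
  by rewrite -ball_normE /= -raddfB/=; exact: le_lt_trans (tr_norm _) xy.
rewrite (_ : A = @trmx R 1 d @` (@trmx R 1 d @^-1` A)); last first.
  apply/seteqP; split=> [x Ax|_ [x Ax <-]//].
  by exists x^T; rewrite /preimage/= ?trmxK.
apply: continuous_compact; first exact: continuous_subspaceT.
apply: bounded_closed_compact.
  exists M; split=> [|K MK x /= /AM xM]; first exact: num_real.
  apply: le_trans (ltW MK); apply: le_trans xM; apply: le_trans (norm_le_enorm _).
  rewrite [leLHS]/Num.Def.normr/= mx_normrE bigmax_le// => -[i j] _ /=.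
  have -> : x i j = x^T j i by rewrite mxE.
  exact: coord_le_norm.
by apply: preimage_closed.
Qed.

End EuclideanNorm.

(** * Geometric errors, covers and words *)

Lemma exists_expr_lt {R : realType} (q K e : R) :
  0 <= q < 1 -> 0 < e -> exists n, q ^+ n * K < e.
Proof.
move=> /andP[q0 q1] e0.
have : `|q| < 1 by rewrite ger0_norm.
move=> /cvg_expr/cvgrPdist_lt/(_ (e / (`|K| + 1))).
case=> [|n _ /(_ n (leqnn n))]; first by rewrite divr_gt0// ltr_wpDl.
rewrite /= sub0r normrN ger0_norm ?exprn_ge0// ltr_pdivlMr ?ltr_wpDl// => qn.
exists n; apply: le_lt_trans qn; rewrite ler_wpM2l ?exprn_ge0//.
by rewrite (le_trans (ler_norm _))// lerDl.
Qed.

Lemma le_of_geometric_error {R : realType} (q K a b : R) :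
  0 <= q < 1 -> (forall n, a <= b + q ^+ n * K) -> a <= b.
Proof.
move=> q01 ab; apply/ler_addgt0Pr => e e0.
have [n qn] := exists_expr_lt K q01 e0.
by rewrite (le_trans (ab n))// lerD2l ltW.
Qed.

Lemma closed_enorm {R : realType} {d} (U : set 'cV[R]_d) :
  (forall x, (forall e, 0 < e -> exists2 y, U y & enorm (y - x) < e) -> U x) ->
  closed U.
Proof. by move=> UP x /closure_enorm/UP. Qed.

(** If a is uncovered it will do; otherwise a set P s containing a lies to the
left of a + l s, so it can be discarded along with that part of the interval. *)
Lemma exists_uncovered {R : realType} {T : eqType} (P : T -> set R) (l : T -> R)
    (L : seq T) (a b : R) :
  (forall s, 0 <= l s) ->
  (forall s x y, P s x -> P s y -> `|x - y| <= l s) ->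
  \sum_(s <- L) l s < b - a ->
  exists t, a <= t <= b /\ forall s, s \in L -> ~ P s t.
Proof.
move=> l0 Pl; move En : (size L) => n.
elim: n L a En => [|n IH] L a En Lb.
  rewrite (size0nil En) big_nil subr_gt0 in Lb *.
  by exists a; rewrite lexx ltW.
have sum0 : 0 <= \sum_(s <- L) l s by rewrite sumr_ge0.
have [[s sL Psa]|nP] := pselect (exists2 s, s \in L & P s a); last first.
  exists a; split=> [|s sL Psa]; last by apply: nP; exists s.
  by rewrite lexx/=; lra.
(* P s may reach the point a + l s itself: step past it by half the slack *)
pose eta := (b - a - \sum_(s <- L) l s) / 2.
have eta0 : 0 < eta by rewrite /eta; lra.
move: Lb; rewrite (perm_big _ (perm_to_rem sL)) big_cons => Lb.
have etaE : eta = (b - a - (l s + \sum_(t <- rem s L) l t)) / 2.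
  by rewrite /eta (perm_big _ (perm_to_rem sL)) big_cons.
have ls := l0 s.
have [||t [/andP[at_ tb] Lt]] := IH (rem s L) (a + l s + eta).
- by rewrite size_rem// En.
- by rewrite etaE; lra.
exists t; split=> [|u uL Put]; first by rewrite tb andbT; lra.
have [us|us] := eqVneq u s.
  rewrite us in Put; have := Pl _ _ _ Put Psa; rewrite ger0_norm; lra.
apply: Lt Put.
by move: uL; rewrite (perm_mem (perm_to_rem sL)) inE (negPf us).
Qed.

(** Intervals of radii r i laid end to end from left to right fill an interval
of radius \sum_i r i; the numbers pos i are their centres. *)
Lemma exists_packing {R : realType} N (r : 'I_N -> R) : (forall i, 0 <= r i) ->
  exists pos : 'I_N -> R, (forall i, `|pos i| <= \sum_i r i - r i) /\
    forall i j, i != j -> r i + r j <= `|pos i - pos j|.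
Proof.
move=> r0; pose left (i : 'I_N) := \sum_(l < N | (l < i)%N) 2 * r l.
have leftS (i : 'I_N) : \sum_(l < N | (l <= i)%N) 2 * r l = left i + 2 * r i.
  rewrite (bigD1 i)//= (eq_bigl (fun l : 'I_N => (l < i)%N)) 1?addrC// => l.
  by rewrite ltn_neqAle andbC.
have sum_mono (P Q : pred 'I_N) : (forall l, P l -> Q l) ->
    \sum_(l | P l) 2 * r l <= \sum_(l | Q l) 2 * r l.
  move=> PQ; rewrite (big_mkcond P) (big_mkcond Q) ler_sum// => l _.
  have rl : 0 <= 2 * r l by rewrite mulr_ge0.
  by case: ifP => [/PQ->//|_]; case: ifP.
exists (fun i => left i + r i - \sum_i r i); split=> [i|].
  have left0 : 0 <= left i by rewrite sumr_ge0// => l _; rewrite mulr_ge0.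
  have : \sum_(l < N | (l <= i)%N) 2 * r l <= \sum_l 2 * r l by exact: sum_mono.
  rewrite leftS -mulr_sumr ler_norml => left_le; apply/andP; split; lra.
have left_lt (i j : 'I_N) : (i < j)%N -> left i + 2 * r i <= left j.
  by move=> ij; rewrite -leftS sum_mono// => l li; exact: leq_ltn_trans ij.
move=> i j; rewrite neq_ltn => /orP[] /left_lt ij.
  by rewrite distrC; apply: le_trans (ler_norm _); lra.
by apply: le_trans (ler_norm _); lra.
Qed.

Fixpoint words (I : finType) k : seq (seq I) :=
  if k is k'.+1 then [seq i :: s | i <- enum I, s <- words I k'] else [:: [::]].

Lemma mem_words (I : finType) (s : seq I) : s \in words I (size s).
Proof.
elim: s => //= i s IH; apply/allpairsP.
by exists (i, s); rewrite mem_enum.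
Qed.

(** * Affine systems with prescribed linear parts *)

Section System.
Context {R : realType} {d N : nat} {B : 'I_N -> 'M[R]_d}.
Implicit Types (a b : 'M[R]_(d, N)) (i j : 'I_N) (s t p u v : seq 'I_N).
Implicit Types (x y : 'cV[R]_d).

Definition sys a : 'I_N -> 'cV[R]_d -> 'cV[R]_d :=
  affine_ifs B (fun i => col i a).

(** An upper bound of the Lipschitz constant of the composition along s. *)
Definition ratio s : R := \prod_(i <- s) opnorm (B i).

Local Notation wm a s := (word_map (sys a) s).
Local Notation S := (\sum_(i < N) opnorm (B i)).

Lemma sys_sub a i x y : sys a i x - sys a i y = B i *m (x - y).
Proof.
rewrite /sys /affine_ifs opprD addrACA subrr addr0 -mulmxBr; congr (_ *m _).
by rewrite opprD addrACA subrr addr0.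
Qed.

Lemma word_map_cat a s t x : wm a (s ++ t) x = wm a s (wm a t x).
Proof. by elim: s => //= i s ->. Qed.

Lemma word_map_fixed a i k : wm a (nseq k i) (col i a) = col i a.
Proof. by elim: k => //= k ->; rewrite /sys /affine_ifs subrr mulmx0 add0r. Qed.

Lemma ratio_nil : ratio [::] = 1. Proof. exact: big_nil. Qed.
Lemma ratio_cons i s : ratio (i :: s) = opnorm (B i) * ratio s.
Proof. exact: big_cons. Qed.
Lemma ratio_cat s t : ratio (s ++ t) = ratio s * ratio t.
Proof. exact: big_cat. Qed.

(** Jointly linear in the fixed points and in the argument, since
sys a i x = B i x + (1 - B i) (col i a). *)
Lemma sys_linear a b (c : R) i x y :
  sys (a + c *: b) i (x + c *: y) = sys a i x + c *: sys b i y.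
Proof.
rewrite /sys /affine_ifs.
have -> : col i (a + c *: b) = col i a + c *: col i b.
  by apply/matrixP => k l; rewrite !mxE.
rewrite scalerDr scalemxAr addrACA -mulmxDr; congr (_ *m _ + _).
by rewrite opprD scalerBr addrACA.
Qed.

Lemma word_map_linear a b (c : R) s x y :
  wm (a + c *: b) s (x + c *: y) = wm a s x + c *: wm b s y.
Proof. by elim: s => //= i s ->; exact: sys_linear. Qed.

Hypothesis d_gt0 : (0 < d)%N.
Hypothesis B_unit : forall i, B i \in unitmx.
Hypothesis B_sum : S < 1.

Lemma ratio1_gt0 i : 0 < opnorm (B i). Proof. exact: opnorm_gt0. Qed.

Lemma ratio_gt0 s : 0 < ratio s.
Proof. by rewrite prodr_gt0// => i _; exact: ratio1_gt0. Qed.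

Lemma ratio1_leS i : opnorm (B i) <= S.
Proof.
by rewrite (bigD1 i)//= lerDl sumr_ge0// => j _; rewrite ltW// ratio1_gt0.
Qed.

Lemma S_ge0 : 0 <= S.
Proof. by rewrite sumr_ge0// => i _; rewrite ltW// ratio1_gt0. Qed.

Lemma S_ge0_lt1 : 0 <= S < 1. Proof. by rewrite S_ge0. Qed.

Lemma ratio_leS s : ratio s <= S ^+ size s.
Proof.
elim: s => [|i s IH]; first by rewrite ratio_nil.
rewrite ratio_cons exprS ler_pM//; first by rewrite ltW// ratio1_gt0.
  by rewrite ltW// ratio_gt0.
exact: ratio1_leS.
Qed.

Lemma ratio_le1 s : ratio s <= 1.
Proof. by rewrite (le_trans (ratio_leS s))// exprn_ile1 ?S_ge0// ltW. Qed.

Lemma word_map_lip a s x y :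
  enorm (wm a s x - wm a s y) <= ratio s * enorm (x - y).
Proof.
elim: s => [|i s IH] /=; first by rewrite ratio_nil mul1r.
rewrite sys_sub ratio_cons -mulrA; apply: le_trans (enorm_mulmx _ _) _.
by rewrite ler_wpM2l// ltW// ratio1_gt0.
Qed.

Lemma word_map_nonexpansive a s x y :
  enorm (wm a s x - wm a s y) <= enorm (x - y).
Proof.
rewrite (le_trans (word_map_lip _ _ _ _))//.
by rewrite ler_piMl ?enorm_ge0// ratio_le1.
Qed.

Lemma word_map_inverse a s : exists f K, [/\ cancel (wm a s) f,
  cancel f (wm a s), 0 <= K & forall x y, enorm (f x - f y) <= K * enorm (x - y)].
Proof.
elim: s => [|i s [f [K [fK Kf K0 fL]]]].
  by exists id, 1; split=> // x y; rewrite mul1r.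
have [m m0 Bm] := enorm_mulmx_ge (B_unit i).
pose g x := invmx (B i) *m (x - col i a) + col i a.
have sysK : cancel (sys a i) g.
  by move=> x; rewrite /g /sys /affine_ifs addrK mulKmx// subrK.
have gK : cancel g (sys a i).
  by move=> x; rewrite /g /sys /affine_ifs addrK mulKVmx// subrK.
exists (f \o g), (K * m^-1); split=> [x|x||x y] /=.
- by rewrite sysK fK.
- by rewrite Kf gK.
- by rewrite mulr_ge0// invr_ge0 ltW.
rewrite (le_trans (fL _ _))// -mulrA ler_wpM2l//.
by rewrite mulrC ler_pdivlMr// mulrC (le_trans (Bm _))// -(sys_sub a) !gK.
Qed.

Lemma word_map_closed a s (U : set 'cV[R]_d) : closed U -> closed (wm a s @` U).
Proof.
move=> Uc; apply: closed_enorm => x xU.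
have [f [k [fK Kf k0 fL]]] := word_map_inverse a s.
exists (f x); last exact: Kf.
apply/Uc/closure_enorm => e e0.
have [|_ [y Uy <-] yx] := xU (e / (k + 1)); first by rewrite divr_gt0// ltr_wpDl.
exists y => //; move: yx; rewrite ltr_pdivlMr ?ltr_wpDl//; apply: le_lt_trans.
rewrite -[y in enorm (y - _)]fK (le_trans (fL _ _))// mulrC ler_wpM2l ?enorm_ge0//.
by rewrite lerDl.
Qed.

(** A ball of this radius about 0 is mapped into itself by all the maps of the
system: |B_i (x - a_i) + a_i| <= S |x| + 2 |a_i|, and d `|a| bounds the
Euclidean norm of every column a_i. It is a multiple of a norm, hence
subadditive and homogeneous in a. *)
Definition radius a : R := 2 * d%:R / (1 - S) * `|a|.

Lemma radius_ge0 a : 0 <= radius a.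
Proof. by rewrite /radius mulr_ge0// divr_ge0 ?mulr_ge0// subr_ge0 ltW. Qed.

Lemma radiusZ (c : R) a : radius (c *: a) = `|c| * radius a.
Proof. by rewrite /radius normrZ mulrCA. Qed.

Lemma radiusD a b : radius (a + b) <= radius a + radius b.
Proof.
rewrite /radius -mulrDr ler_wpM2l ?ler_normD//.
by rewrite divr_ge0 ?mulr_ge0// subr_ge0 ltW.
Qed.

Lemma enorm_col_le_radius a i : 2 * enorm (col i a) <= (1 - S) * radius a.
Proof.
rewrite /radius mulrA mulrCA divff ?mulr1 ?gt_eqF ?subr_gt0//.
by rewrite -mulrA ler_wpM2l// enorm_le_norm.
Qed.

Lemma enorm_sys_le_radius a i x :
  enorm x <= radius a -> enorm (sys a i x) <= radius a.
Proof.
move=> xr; have ca := enorm_col_le_radius a i.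
have e0 := enorm_ge0 (col i a).
rewrite /sys /affine_ifs (le_trans (enormD _ _))//.
have : enorm (B i *m (x - col i a)) <= S * (radius a) + enorm (col i a).
  apply: le_trans (enorm_mulmx _ _) _.
  apply: (@le_trans _ _ (opnorm (B i) * (radius a + enorm (col i a)))).
    rewrite ler_wpM2l ?(ltW (ratio1_gt0 _))//.
    by rewrite (le_trans (enormD _ _))// enormN lerD2r.
  rewrite mulrDr lerD//; first by rewrite ler_wpM2r ?radius_ge0// ratio1_leS.
  rewrite ler_piMl//; apply: le_trans (ratio1_leS i) _; exact: ltW.
lra.
Qed.

Lemma enorm_word_map_le_radius a s x :
  enorm x <= radius a -> enorm (wm a s x) <= radius a.
Proof. by move=> xr; elim: s => //= i s; exact: enorm_sys_le_radius. Qed.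

Lemma col_in_radius a i : enorm (col i a) <= radius a.
Proof.
have := enorm_col_le_radius a i; have := enorm_ge0 (col i a).
have := radius_ge0 a; have := S_ge0; have := B_sum; nra.
Qed.

(** The attractor is the intersection of the decreasing sets K n, the unions of
the images of an invariant ball under all words of length n. For a point x of
the intersection, some first letter i must serve for all n: otherwise each
letter fails at some n, hence at all later ones, and all letters fail at the
largest of these. As sys a i is injective, the preimage of x under it is then
in every K n. *)
Lemma exists_attractor a (i0 : 'I_N) : exists A, is_attractor (sys a) A.
Proof.
pose K n : set 'cV[R]_d := \bigcup_(s in [set: n.-tuple 'I_N])
  (wm a s @` [set x | enorm x <= radius a]).
have Kclosed n : closed (K n).
  apply: closed_bigcup => [|s _]; first exact: finite_finset.
  apply: word_map_closed; apply: closed_enorm => x xU.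
  apply/ler_addgt0Pr => e e0; have [y yr yx] := xU e e0.
  rewrite -[x](subKr y) (le_trans (enormD _ _))// enormN lerD// ltW//.
have Kdecr m n : (n <= m)%N -> K m `<=` K n.
  move=> nm _ [s _ [x xr <-]].
  have st : size (take n s) == n by rewrite size_takel// size_tuple.
  exists (Tuple st) => //; exists (wm a (drop n s) x).
    exact: enorm_word_map_le_radius.
  by rewrite -word_map_cat cat_take_drop.
exists (\bigcap_n K n); split.
- exists (col i0 a) => n _; exists [tuple of nseq n i0] => //.
  by exists (col i0 a); [exact: col_in_radius|exact: word_map_fixed].
- apply: (bounded_closed_compact_cV (M := radius a)).
    by move=> _ /(_ 0%N I) [s _ [x xr <-]]; exact: enorm_word_map_le_radius.
  by apply: closed_bigI => n _; exact: Kclosed.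
apply/seteqP; split=> [x Kx|_ [i _ [x Kx <-]] n _]; last first.
  case: n => [|n].
    have [s _ [y yr xE]] := Kx 0%N I.
    exists [tuple] => //; exists (sys a i x) => //=.
    by rewrite -xE; exact/enorm_sys_le_radius/enorm_word_map_le_radius.
  have [s _ [y yr <-]] := Kx n I.
  by exists [tuple of i :: s] => //; exists y.
have winv i : exists f, cancel (sys a i) f /\ cancel f (sys a i).
  by have [f [k [fK Kf _ _]]] := word_map_inverse a [:: i]; exists f.
apply: contrapT => nx.
have /choice[h hP] : forall i, exists n, ~ exists2 y, K n y & sys a i y = x.
  move=> i; apply: contrapT => /forallNP hn; apply: nx.
  have [f [fK Kf]] := winv i.
  exists i => //; exists (f x); last exact: Kf.
  by move=> n _; have /contrapT[y Ky <-] := hn n; rewrite fK.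
have [s _ [y yr xE]] := Kx (\max_i h i).+1 I.
case/tupleP: s xE => i s /= xE.
apply: (hP i); exists (wm a s y) => //.
by apply: (Kdecr (\max_i h i)); [exact: leq_bigmax|exists s => //; exists y].
Qed.


(** * The attractor and its nodes *)

Variable i0 : 'I_N.

Local Notation attr a := (attractor (sys a)).

Lemma attractorP a : is_attractor (sys a) (attr a).
Proof.
by have [A AP] := exists_attractor a i0; exact: (xgetPex set0 (ex_intro _ A AP)).
Qed.

Lemma attractor_closed a : closed (attr a).
Proof.
have [_ Ac _] := attractorP a.
by apply: compact_closed => //; exact: norm_hausdorff.
Qed.

Lemma attractor_word_map a s x : attr a x -> attr a (wm a s x).
Proof.
move=> Ax; elim: s => //= i s IH.
by have [_ _ ->] := attractorP a; exists i => //; exists (wm a s x).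
Qed.

Lemma attractor_decomp a n x : attr a x ->
  exists s y, [/\ size s = n, attr a y & x = wm a s y].
Proof.
elim: n x => [|n IH] x Ax; first by exists [::], x.
move: Ax; have [_ _ {1}->] := attractorP a => -[i _ [y Ay <-]].
have [s [y' [sn Ay' ->]]] := IH y Ay.
by exists (i :: s), y'; rewrite /= sn.
Qed.

(** Points of A are within S ^ n times a constant of the image of a point of the
invariant ball, for every n; the constant comes from the compactness of A. *)
Lemma attractor_bounded a x : attr a x -> enorm x <= radius a.
Proof.
have [_ /compact_bounded[M [_ AM]] _] := attractorP a.
have {}AM y : attr a y -> `|y| <= M + 1 by apply: AM; rewrite ltrDl.
move=> Ax.
apply: (le_of_geometric_error (K := d%:R * (M + 1) + radius a) S_ge0_lt1) => n.
have [s [y [<- Ay ->]]] := attractor_decomp n Ax.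
rewrite -[wm a s y](subrK (wm a s (col i0 a))) addrC.
rewrite (le_trans (enormD _ _))// lerD//.
  exact/enorm_word_map_le_radius/col_in_radius.
apply: le_trans (word_map_lip _ _ _ _) _.
apply: ler_pM => //; rewrite ?enorm_ge0// ?(ltW (ratio_gt0 _)) ?ratio_leS//.
rewrite (le_trans (enormD _ _))// enormN lerD// ?col_in_radius//.
have -> : y = col ord0 y by apply/matrixP => k l; rewrite !mxE ord1.
by rewrite (le_trans (enorm_le_norm _ _))// ler_wpM2l// AM.
Qed.

Lemma fixed_point_attractor a : attr a (col i0 a).
Proof.
have [[x Ax] _ _] := attractorP a.
apply/attractor_closed/closure_enorm => e e0.
have [n ne] := exists_expr_lt (enorm (x - col i0 a)) S_ge0_lt1 e0.
exists (wm a (nseq n i0) x); first exact: attractor_word_map.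
rewrite -{1}(word_map_fixed a i0 n); apply: le_lt_trans ne.
rewrite (le_trans (word_map_lip _ _ _ _))// ler_wpM2r ?enorm_ge0//.
by rewrite (le_trans (ratio_leS _))// size_nseq.
Qed.

(** The base point is the fixed point of one of the maps, so that all nodes lie
on the attractor and depend linearly on a. *)
Definition node a s := wm a s (col i0 a).

Lemma attractor_node a s : attr a (node a s).
Proof. exact/attractor_word_map/fixed_point_attractor. Qed.

Lemma enorm_node a s : enorm (node a s) <= radius a.
Proof. exact/attractor_bounded/attractor_node. Qed.

Lemma node_linear a b (c : R) s : node (a + c *: b) s = node a s + c *: node b s.
Proof.
rewrite /node -word_map_linear; congr word_map.
by apply/matrixP => k l; rewrite !mxE.
Qed.

Lemma node_near a s x : attr a x ->
  enorm (wm a s x - node a s) <= ratio s * (2 * radius a).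
Proof.
move=> Ax; rewrite (le_trans (word_map_lip _ _ _ _))//.
rewrite ler_wpM2l ?(ltW (ratio_gt0 _))// (le_trans (enormD _ _))// enormN.
have := attractor_bounded Ax; have := col_in_radius a i0; lra.
Qed.

(** Some point of w_p(A), namely node a (p ++ v), has distance at least e from
w_q(A) for all q != p of the length of p: each such w_q(A) is the union of the
w_s(A) over the words s extending q by k letters, and w_s(A) is within
ratio s * (2 * radius a) of node a s. *)
Definition escape p : set 'M[R]_(d, N) := [set a | exists v k (e : R), 0 < e /\
  forall s, size s = (size p + k)%N -> take (size p) s != p ->
  ratio s * (2 * radius a) + e <= enorm (node a (p ++ v) - node a s)].

(** Take x in V and A, with V the open set for length n = size p. A common value
w_p x = w_q y with y in A would make w_p^-1 (w_q y') a point of V for every y'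
close to y, in particular for some y' in V and A, against the disjointness of
w_p(V) and w_q(V). So w_p x is at positive distance from the compact union of
the w_q(A); nodes close to w_p x and cylinders of small diameter then satisfy
escape p. *)
Lemma SMP_escape a p : SMP (sys a) -> escape p a.
Proof.
move=> smp; have [/eqP/nilP ->|] := eqVneq (size p) 0%N.
  by exists [::], 0%N, 1; split=> // s _; rewrite take0.
rewrite -lt0n => /smp[V [Vopen VA disj]].
have [[x0 Ax0] _ _] := attractorP a.
have [x [Vx Ax] _] : exists2 x, (V `&` attr a) x & enorm (x - x0) < 1.
  by apply: (iffLR (closure_enorm _ _)) => //; rewrite VA.
have pxq (q : (size p).-tuple 'I_N) : q != in_tuple p ->
    ~ (wm a q @` attr a) (wm a p x).
  move=> qp [y Ay yx].
  have [f [k [fK Kf k0 fL]]] := word_map_inverse a p.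
  have /nbhs_enorm[e e0 xV] : nbhs x V by exact: open_nbhs_nbhs.
  have : closure (V `&` attr a) y by rewrite VA.
  move/closure_enorm/(_ (e / (k + 1))).
  case=> [|y' [Vy' Ay'] yy']; first by rewrite divr_gt0// ltr_wpDl.
  have : (wm a q @` V `&` wm a (in_tuple p) @` V) (wm a q y').
    split; first by exists y'.
    exists (f (wm a q y')); last exact: Kf.
    apply: xV; rewrite -(fK x) -yx (le_lt_trans (fL _ _))//.
    move: yy'; rewrite ltr_pdivlMr ?ltr_wpDl//; apply: le_lt_trans.
    rewrite mulrC ler_pM ?enorm_ge0 ?word_map_nonexpansive//.
    by rewrite lerDl.
  by rewrite disj.
pose F := \bigcup_(q in [set q : (size p).-tuple 'I_N | q != in_tuple p])
  (wm a q @` attr a).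
have Fc : closed F.
  apply: closed_bigcup => [|q _]; first exact: finite_finset.
  exact/word_map_closed/attractor_closed.
have [e e0 Fe] : exists2 e, 0 < e & forall y, F y -> e <= enorm (y - wm a p x).
  apply: contrapT => ne.
  suff /Fc[q qp] : closure F (wm a p x) by exact: pxq.
  apply/closure_enorm => e e0; apply: contrapT => ny; apply: ne.
  exists e => // y Fy; rewrite leNgt; apply/negP => ye; apply: ny.
  by exists y.
have e4 : 0 < e / 4 by lra.
have [m Sm] := exists_expr_lt (2 * radius a) S_ge0_lt1 e4.
have [v [y [vm Ay xE]]] := attractor_decomp m Ax.
exists v, m, (e / 2); split=> [|s sm sp]; first by lra.
have rD : 0 <= 2 * radius a by rewrite mulr_ge0// radius_ge0.
have short t : size t = m -> ratio t * (2 * radius a) < e / 4.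
  move=> tm; apply: le_lt_trans Sm; rewrite ler_wpM2r//.
  by rewrite -tm ratio_leS.
have sF : F (node a s).
  have ts : size (take (size p) s) == size p by rewrite size_takel// sm leq_addr.
  exists (Tuple ts); first by apply: contraNN sp => /eqP[->].
  exists (node a (drop (size p) s)); first exact: attractor_node.
  by rewrite /node -word_map_cat cat_take_drop.
have spx := Fe _ sF.
have rs : ratio s * (2 * radius a) <= e / 4.
  rewrite -(cat_take_drop (size p) s) ratio_cat.
  have /short/ltW : size (drop (size p) s) = m by rewrite size_drop sm addKn.
  apply: le_trans; rewrite ler_wpM2r// ler_piMl ?ratio_le1//.
  exact/ltW/ratio_gt0.
have px : enorm (wm a p x - node a (p ++ v)) <= e / 4.
  rewrite xE /node word_map_cat (le_trans (word_map_nonexpansive _ _ _ _))//.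
  exact: le_trans (node_near _ Ay) (ltW (short _ vm)).
have := enormB_le (wm a p x) (node a (p ++ v)) (node a s).
rewrite -(enormBC (node a s)); lra.
Qed.

(** The words g of L are treated one after the other; handling g replaces the
cylinder of u by a smaller one, on which the conclusions obtained earlier stay
true. For g, escape (g ++ u) gives a node that starts with g ++ u and avoids
w_h(A) for h != g; all points of A in a small cylinder around that node do. *)
Lemma escape_refine a n (L : seq (seq 'I_N)) u : (forall p, escape p a) ->
  (forall g, g \in L -> size g = n) ->
  exists v (e : R), 0 < e /\ forall x g h y, attr a x -> g \in L ->
    size h = n -> h != g -> attr a y ->
    e <= enorm (wm a g (wm a (u ++ v) x) - wm a h y).
Proof.
move=> esc; elim: L u => [|g L IH] u Ln; first by exists [::], 1.
(* v leads to the good node; the letters i0 shrink the cylinder around it *)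
have [v [k [e [e0 ve]]]] := esc (g ++ u).
have e2 : 0 < e / 2 by lra.
have [m Sm] := exists_expr_lt (2 * radius a) S_ge0_lt1 e2.
have {IH} [w [e' [e'0 IH]]] : exists v' (e : R), 0 < e /\
    forall x g h y, attr a x -> g \in L -> size h = n -> h != g -> attr a y ->
    e <= enorm (wm a g (wm a ((u ++ v ++ nseq m i0) ++ v') x) - wm a h y).
  by apply: IH => h hL; apply: Ln; rewrite inE hL orbT.
exists ((v ++ nseq m i0) ++ w), (Num.min (e / 2) e').
split=> [|x g' h y Ax]; first by rewrite lt_min e2.
rewrite inE => /orP[/eqP->|g'L] hn hg Ay; last first.
  by rewrite ge_min; apply/orP; right; rewrite catA; exact: IH.
rewrite ge_min; apply/orP; left.
have [t [y' [ts Ay' yE]]] := attractor_decomp (size u + k)%N Ay.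
have gn : size g = n by apply: Ln; rewrite inE eqxx.
have hts : size (h ++ t) = (size (g ++ u) + k)%N.
  by rewrite !size_cat hn gn ts addnA.
have {hts} far := ve _ hts.
have {}far : ratio (h ++ t) * (2 * radius a) + e <=
    enorm (node a ((g ++ u) ++ v) - node a (h ++ t)).
  apply: far; apply: contraNN hg => /eqP/(congr1 (take n)).
  rewrite take_takel ?size_cat ?gn ?leq_addr// -{1}hn take_size_cat// => ->.
  by rewrite -gn take_size_cat.
have yn : enorm (node a (h ++ t) - wm a h y) <= ratio (h ++ t) * (2 * radius a).
  by rewrite yE -word_map_cat enormBC node_near.
have Aw : attr a (wm a w x) by exact: attractor_word_map.
have xn : enorm (node a ((g ++ u) ++ v) -
    wm a g (wm a (u ++ (v ++ nseq m i0) ++ w) x)) <= e / 2.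
  have -> : node a ((g ++ u) ++ v) = wm a (g ++ u ++ v) (node a (nseq m i0)).
    by rewrite /node word_map_fixed catA.
  have -> : wm a g (wm a (u ++ (v ++ nseq m i0) ++ w) x) =
      wm a (g ++ u ++ v) (wm a (nseq m i0) (wm a w x)).
    by rewrite -!word_map_cat !catA.
  rewrite (le_trans (word_map_nonexpansive _ _ _ _))// enormBC.
  rewrite (le_trans (node_near _ Aw))// (le_trans _ (ltW Sm))//.
  rewrite ler_wpM2r//; first by rewrite mulr_ge0// radius_ge0.
  by rewrite (le_trans (ratio_leS _))// size_nseq.
set X := wm a g (wm a _ x) in xn *.
have := enormB_le (node a ((g ++ u) ++ v)) X (node a (h ++ t)).
have := enormB_le X (wm a h y) (node a (h ++ t)).
move: yn; rewrite (enormBC _ (wm a h y)); lra.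
Qed.

(** The open set consists of the x for which, for some e, the distance from x to
A is less than e while w_g x is at distance at least e from every other w_h(A).
If w_g x = w_h x', compare the two values of e: the point with the smaller one
is within it of A, so its image contradicts the condition on the other point. *)
Lemma escape_SMP a : (forall p, escape p a) -> SMP (sys a).
Proof.
move=> esc n n0.
exists [set x | exists e : R, [/\ 0 < e,
  exists2 y, attr a y & enorm (x - y) < e &
  forall g h : n.-tuple 'I_N, g != h -> forall y, attr a y ->
    e <= enorm (wm a g x - wm a h y)]].
split.
- apply: open_enorm => x [e [e0 [y Ay xy] far]].
  exists ((e - enorm (x - y)) / 3) => [|x' xx']; first by lra.
  exists (e - enorm (x' - x)); split.
  + by have := enorm_ge0 (x - y); lra.
  + by exists y => //; have := enormB_le x' x y; have := enorm_ge0 (x' - x); lra.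
  + move=> g h gh y' Ay'; have := far _ _ gh _ Ay'.
    have := enormB_le (wm a g x) (wm a g x') (wm a h y').
    have := word_map_nonexpansive a g x x'; rewrite (enormBC x'); lra.
- apply/seteqP; split.
    apply: (subset_trans _ (@attractor_closed a)).
    by apply: closure_subset => x [].
  move=> x Ax; apply/closure_enorm => e e0.
  have [m Sm] := exists_expr_lt (2 * radius a) S_ge0_lt1 e0.
  have [u [y [um Ay ->]]] := attractor_decomp m Ax.
  pose L := [seq tval g | g <- enum {: n.-tuple 'I_N}].
  have [|v [e' [e'0 far]]] := @escape_refine a n L u esc.
    by move=> _ /mapP[g _ ->]; rewrite size_tuple.
  have Auv := attractor_word_map (u ++ v) Ay.
  exists (wm a (u ++ v) y).
    split=> //; exists e'; split=> //.
      by exists (wm a (u ++ v) y); rewrite ?subrr ?enorm0.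
    move=> g h gh y' Ay'; apply: far => //.
    - by apply: map_f; rewrite mem_enum.
    - by rewrite size_tuple.
    - by apply: contraNneq gh => /val_inj ->.
  rewrite word_map_cat (le_lt_trans _ Sm)// (le_trans (word_map_lip _ _ _ _))//.
  rewrite ler_pM ?enorm_ge0 ?(ltW (ratio_gt0 _))//; first by rewrite -um ratio_leS.
  rewrite (le_trans (enormD _ _))// enormN.
  have := attractor_bounded Ay.
  have := attractor_bounded (attractor_word_map v Ay); lra.
- have aux (g h : n.-tuple 'I_N) (x x' : 'cV[R]_d) (e e' : R) : g != h ->
      (exists2 y, attr a y & enorm (x - y) < e) -> e <= e' ->
      (forall y, attr a y -> e' <= enorm (wm a g x' - wm a h y)) ->
      wm a g x' != wm a h x.
    move=> gh [y Ay xy] ee' /(_ y Ay) far; apply/eqP => E.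
    by have := word_map_nonexpansive a h x y; move: far; rewrite E; lra.
  move=> g h gh; apply/seteqP; split=> // _ [[x [e [_ Ax xfar]] <-]].
  move=> [x' [e' [_ Ax' x'far]] E].
  case: (leP e e') => ee'.
    have hg : h != g by rewrite eq_sym.
    by have /eqP := aux h g x x' e e' hg Ax ee' (x'far _ _ hg).
  have /eqP := aux g h x' x e' e gh Ax' (ltW ee') (xfar _ _ gh).
  by rewrite E.
Qed.

Lemma node_sub a b s : node a s - node b s = node (a - b) s.
Proof.
by have := node_linear a b (-1) s; rewrite !scaleN1r => ->.
Qed.

(** The same v and k serve near a, with half the margin: no node moves by more
than radius (b - a), whatever the length of the word. *)
Lemma escape_open p : open (escape p).
Proof.
rewrite openE => a [v [k [e [e0 far]]]].
pose C := 2 * d%:R / (1 - S) : R.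
have C0 : 0 <= C by rewrite divr_ge0 ?mulr_ge0// subr_ge0 ltW.
apply/nbhs_ballP; exists (e / 8 / (C + 1)) => /=.
  by rewrite divr_gt0 ?divr_gt0// ltr_wpDl.
move=> b; rewrite -ball_normE /= => ab.
have rab : radius (b - a) <= e / 8.
  move: ab; rewrite ltr_pdivlMr ?ltr_wpDl// => /ltW; apply: le_trans.
  by rewrite /radius -/C distrC mulrC ler_wpM2l// lerDl.
exists v, k, (e / 2); split=> [|s sk sp]; first by lra.
have := far s sk sp.
have rb : radius b <= radius a + e / 8.
  rewrite -[b](subrKC a) (le_trans (radiusD _ _))// lerD2l//.
have : ratio s * (2 * radius b) <= ratio s * (2 * radius a) + e / 4.
  have := ratio_le1 s; have := ratio_gt0 s; nra.
have := enormB_le (node a (p ++ v)) (node b (p ++ v)) (node a s).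
have := enormB_le (node b (p ++ v)) (node b s) (node a s).
have := enorm_node (b - a) (p ++ v); have := enorm_node (b - a) s.
rewrite -!node_sub (enormBC (node a (p ++ v)) (node b (p ++ v))); lra.
Qed.

(** * Density *)

Lemma sum_ratio k : \sum_(s <- words 'I_N k) ratio s = S ^+ k.
Proof.
elim: k => [|k IH]; first by rewrite big_seq1 ratio_nil.
rewrite /= big_allpairs_dep exprS mulr_suml big_enum/=.
apply: eq_bigr => i _; rewrite -IH mulr_sumr.
by apply: eq_bigr => s _; exact: ratio_cons.
Qed.

Lemma ratio_lower_bound k :
  exists2 m, 0 < m & forall s, size s = k -> m <= ratio s.
Proof.
have r1 i : 0 <= opnorm (B i) <= 1.
  by rewrite ltW ?ratio1_gt0//= (le_trans (ratio1_leS i))// ltW.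
exists ((\prod_i opnorm (B i)) ^+ k).
  by rewrite exprn_gt0// prodr_gt0// => i _; exact: ratio1_gt0.
have p0 : 0 <= \prod_i opnorm (B i).
  by rewrite prodr_ge0// => i _; rewrite ltW// ratio1_gt0.
move=> s <-; elim: s => [|i s IH]; first by rewrite ratio_nil.
rewrite /= exprS ratio_cons ler_pM ?exprn_ge0// (bigD1 i)//= ler_piMr//.
  by rewrite ltW// ratio1_gt0.
by rewrite prodr_ile1.
Qed.

(** The translation part of sys b i is (1 - B i) (col i b), and 1 - B i is
invertible because B i is a contraction. *)
Lemma exists_translations (c : 'I_N -> 'cV[R]_d) :
  exists b, forall i x, sys b i x = B i *m x + c i.
Proof.
have Iu i : 1%:M - B i \in unitmx.
  rewrite unitmxE unitfE -det_tr; apply/det0P => -[v v0 /(congr1 trmx)].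
  rewrite trmx_mul trmxK trmx0 mulmxBl mul1mx => /eqP.
  rewrite subr_eq0 => /eqP vB.
  have : enorm v^T = 0.
    apply/eqP; rewrite eq_le enorm_ge0 andbT.
    have := enorm_mulmx (B i) v^T; rewrite -vB.
    have := enorm_ge0 v^T; have := ratio1_leS i; have := B_sum; nra.
  by move/enorm_eq0/(congr1 trmx); rewrite trmxK trmx0; move/eqP: v0.
exists (\matrix_(k, i) (invmx (1%:M - B i) *m c i) k ord0) => i x.
rewrite /sys /affine_ifs.
have -> : col i (\matrix_(k, i) (invmx (1%:M - B i) *m c i) k ord0) =
    invmx (1%:M - B i) *m c i.
  by apply/matrixP => k l; rewrite mxE mxE (ord1 l).
rewrite mulmxBr -addrA; congr (_ + _).
by rewrite addrC -{1}[invmx _ *m _]mul1mx -mulmxBl mulKVmx.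
Qed.

(** Choose b so that sys b i x = B i x + pos i e1, with pos i the centres given
by exists_packing for the radii |B_i|. The ball of radius S about 0 is
invariant, and its images under the maps are within balls of radii S |B_i| about
the points pos i e1, so that distinct first letters separate points by at least
|B_i| (1 - S). A common prefix is removed with a lower bound for the invertible
matrices. *)
Lemma exists_separating_direction : exists b,
  forall p, exists2 c, 0 < c & forall s, (size p <= size s)%N ->
    take (size p) s != p -> c <= enorm (node b p - node b s).
Proof.
pose e1 : 'cV[R]_d := delta_mx (Ordinal d_gt0) ord0.
have e1_norm : enorm e1 = 1.
  rewrite /enorm (bigD1 (Ordinal d_gt0))//= big1 => [|k kd].
    by rewrite mxE !eqxx/= expr1n addr0 sqrtr1.
  by rewrite mxE (negPf kd)/= expr0n.
have [|pos [pos_in pos_far]] := @exists_packing _ _ (fun i => opnorm (B i)).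
  by move=> i; rewrite ltW// ratio1_gt0.
have [b bE] := exists_translations (fun i => pos i *: e1).
have ball i x : enorm x <= S -> enorm (sys b i x) <= S.
  move=> xS; rewrite bE (le_trans (enormD _ _))// enormZ e1_norm mulr1.
  have := pos_in i; have := enorm_mulmx (B i) x.
  have := ratio1_gt0 i; have := B_sum; have := enorm_ge0 x; nra.
have word_ball s x : enorm x <= S -> enorm (wm b s x) <= S.
  by move=> xS; elim: s => //= i s; exact: ball.
have base : enorm (col i0 b) <= S.
  have cE : col i0 b = B i0 *m col i0 b + pos i0 *: e1.
    by rewrite -bE /sys /affine_ifs subrr mulmx0 add0r.
  have : enorm (col i0 b) <= opnorm (B i0) * enorm (col i0 b) + `|pos i0|.
    rewrite {1}cE (le_trans (enormD _ _))// enormZ e1_norm mulr1 lerD2r.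
    exact: enorm_mulmx.
  have := pos_in i0; have := ratio1_leS i0; have := ratio1_gt0 i0.
  have := B_sum; have := enorm_ge0 (col i0 b); nra.
have gap i j x y : i != j -> enorm x <= S -> enorm y <= S ->
    opnorm (B i) * (1 - S) <= enorm (sys b i x - sys b j y).
  move=> ij xS yS; have pf := pos_far _ _ ij.
  have : `|pos i - pos j| <= enorm (sys b i x - sys b j y)
      + enorm (B i *m x) + enorm (B j *m y).
    rewrite -[leLHS]mulr1 -e1_norm -enormZ scalerBl.
    have -> : pos i *: e1 - pos j *: e1 =
        (sys b i x - sys b j y) - B i *m x + B j *m y.
      rewrite !bE; set X := B i *m x; set Y := B j *m y.
      by apply/matrixP => k l; rewrite !mxE; ring.
    rewrite (le_trans (enormD _ _))// lerD2r.
    by rewrite (le_trans (enormD _ _))// enormN.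
  have := enorm_mulmx (B i) x; have := enorm_mulmx (B j) y.
  have := ratio1_gt0 i; have := ratio1_gt0 j; have := B_sum.
  have := enorm_ge0 x; have := enorm_ge0 y; nra.
exists b => p.
suff [c c0 H] : exists2 c, 0 < c & forall s x y, enorm x <= S -> enorm y <= S ->
    (size p <= size s)%N -> take (size p) s != p ->
    c <= enorm (wm b p x - wm b s y).
  by exists c => // s; exact: H.
elim: p => [|i p [c c0 IH]].
  by exists 1 => // s x y _ _ _; rewrite take0.
have [m m0 Bm] := enorm_mulmx_ge (B_unit i).
exists (Num.min (opnorm (B i) * (1 - S)) (m * c)).
  by rewrite lt_min !mulr_gt0 ?ratio1_gt0// subr_gt0.
case=> // j s x y xS yS /= ps; rewrite eqseq_cons negb_and => ijs.
have [ij|ij] := eqVneq i j; last first.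
  by rewrite ge_min gap// word_ball.
move: ijs; rewrite ij eqxx/= => ijs.
rewrite ge_min -ij; apply/orP; right; rewrite sys_sub (le_trans _ (Bm _))//.
by rewrite ler_wpM2l ?(ltW m0)//; exact: IH.
Qed.

(** On the line a0 + t b, a word s that does not extend p forbids a set P s of
parameters of diameter at most (2 H / c) ratio s. Here H bounds 2 radius for all
t in [0, T], increased by 1: the increment, times ratio s, leaves the margin
that escape p demands. *)
Lemma escape_dense p : dense (escape p).
Proof.
move=> U [a0 Ua0] Uopen.
have /nbhs_ballP[e /= e0 a0U] : nbhs a0 U by exact: open_nbhs_nbhs.
have [b /(_ p)[c c0 bc]] := exists_separating_direction.
pose T : R := e / 2 / (`|b| + 1).
have T0 : 0 < T by rewrite !divr_gt0// ltr_wpDl.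
pose H : R := 2 * (radius a0 + T * radius b) + 1.
have H0 : 0 < H.
  rewrite /H; have := radius_ge0 a0; have := radius_ge0 b; nra.
pose P s : set R := [set t | take (size p) s != p /\ (size p <= size s)%N /\
  enorm (node (a0 + t *: b) p - node (a0 + t *: b) s) < ratio s * H].
have P_short s (t t' : R) : P s t -> P s t' -> `|t - t'| <= 2 * H / c * ratio s.
  move=> [sp [ps Pt]] [_ [_ Pt']].
  have cs := bc s ps sp.
  rewrite mulrAC ler_pdivlMr//.
  apply: (@le_trans _ _ (`|t - t'| * enorm (node b p - node b s))).
    by rewrite ler_wpM2l.
  rewrite -enormZ scalerBr !scalerBl.
  move: Pt Pt'; rewrite !node_linear.
  set X := node a0 p; set Y := node a0 s; set Z := node b p; set W := node b s.
  have -> : t *: Z - t' *: Z - (t *: W - t' *: W) =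
    (X + t *: Z - (Y + t *: W)) - (X + t' *: Z - (Y + t' *: W)).
    by apply/matrixP => k l; rewrite !mxE; ring.
  by move=> ? ?; rewrite (le_trans (enormD _ _))// enormN; lra.
have [k kT] := exists_expr_lt (2 * H / c) S_ge0_lt1 T0.
have l0 s : 0 <= 2 * H / c * ratio s.
  by rewrite !mulr_ge0 ?invr_ge0 ?(ltW (ratio_gt0 _)) ?ltW.
have [|t [/andP[t0 tT] Pt]] := exists_uncovered (P := P)
    (L := words 'I_N (size p + k)) (a := 0) (b := T) l0 P_short.
  rewrite subr0 -mulr_sumr sum_ratio mulrC; apply: le_lt_trans kT.
  rewrite ler_wpM2r//; first by rewrite ltW// divr_gt0// mulr_gt0.
  rewrite exprD ler_piMl ?exprn_ge0 ?S_ge0// exprn_ile1 ?S_ge0// ltW//.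
have tb : `|t| <= T by rewrite ger0_norm.
exists (a0 + t *: b); split.
  apply: a0U; rewrite -ball_normE /= opprD addNKr normrN normrZ.
  apply: (@le_lt_trans _ _ (e / 2)); last by lra.
  apply: (@le_trans _ _ (T * (`|b| + 1))); first by rewrite ler_pM// lerDl.
  by rewrite /T divfK// gt_eqF// ltr_wpDl.
have [m m0 mr] := ratio_lower_bound (size p + k).
exists [::], k, m; split=> // s sk sp; rewrite cats0.
have /Pt nP : s \in words 'I_N (size p + k) by rewrite -sk mem_words.
have far : ratio s * H <= enorm (node (a0 + t *: b) p - node (a0 + t *: b) s).
  rewrite leNgt; apply/negP => near; apply: nP; split=> //.
  by rewrite sk leq_addr.
apply: le_trans far; have := mr s sk; have := ratio_gt0 s.
have : radius (a0 + t *: b) <= radius a0 + T * radius b.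
  rewrite (le_trans (radiusD _ _))// lerD2l radiusZ ler_wpM2r// radius_ge0//.
rewrite /H; nra.
Qed.

End System.

(** The Baire category theorem applies to a complete normed space. *)
HB.instance Definition _ (R : realType) m n := Complete.on 'M[R]_(m, n).

Theorem theorem4 (R : realType) (d N : nat) (hd : (0 < d)%N) (hN : (0 < N)%N)
    (B : 'I_N -> 'M[R]_d)
    (B_unit : forall i : 'I_N, B i \in unitmx)
    (B_contr : forall i : 'I_N, contraction_mx (B i))
    (B_sum : \sum_(i < N) opnorm (B i) < 1) :
  dense (E_set B) /\ Gdelta (E_set B).
Proof.
pose i0 := Ordinal hN.
pose F n : set 'M[R]_(d, N) :=
  if unpickle n is Some p then escape (B := B) i0 p else setT.
have Fopen n : open (F n).
  rewrite /F; case: unpickle => [p|]; last exact: openT.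
  exact: escape_open.
have Fdense n : dense (F n).
  rewrite /F; case: unpickle => [p|]; first exact: escape_dense.
  by move=> U U0 _; rewrite setIT.
have -> : E_set B = \bigcap_n F n.
  apply/seteqP; split=> [a smp n _|a Fa].
    by rewrite /F; case: unpickle => // p; exact: SMP_escape.
  apply: (escape_SMP hd B_unit B_sum (i0 := i0)) => p.
  by have := Fa (pickle p) I; rewrite /F pickleK.
split; last by exists F.
exact: Baire.
Qed.
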